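(* Suppose $Y \subset \mathbb{T}^2=\mathbb{T}\times\mathbb{T}$ is infinite and both of the projections onto the $\mathbb{T}$ factors are injective on $Y$. Then for all $\epsilon>0$ there exists $(n,m) \in \mathbb{N}^2$ such that $(n,m)Y$ is $\epsilon$-dense in $\mathbb{T}^2$. In fact, if $P_1(x),P_2(x) \in \mathbb{Z}[x]$ are polynomials such that no non-trivial linear combination of them is constant, then for all $\epsilon>0$ there exists $n \in \mathbb{N}$ such that $(P_1(n), P_2(n))Y$ is $\epsilon$-dense in $\mathbb{T}^2$.
   Context: $\mathbb{T}=\mathbb{R}/\mathbb{Z}$. For integers $a,b$ and $Y\subset\mathbb{T}^2$, $(a,b)Y=\{(ay_1,by_2) : (y_1,y_2)\in Y\}$. ''No non-trivial linear combination is constant'' means that for all $(c_1,c_2)\in\mathbb{R}^2\setminus\{(0,0)\}$ the polynomial $c_1P_1(x)+c_2P_2(x)$ is non-constant. For $u\in\mathbb{T}^2$, $|u|$ denotes the $\|\cdot\|_\infty$-distance from the origin of $\mathbb{R}^2$ to the closest point of the preimage of $u$ in $\mathbb{R}^2$. A subset $Z\subset\mathbb{T}^2$ is $\epsilon$-dense if for every $\alpha\in\mathbb{T}^2$ there is $z\in Z$ with $|\alpha-z|\le\epsilon$. *)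

(* Defs.v *)
From mathcomp Require Import all_boot all_order all_algebra generic_quotient.
From mathcomp Require Import all_classical all_reals all_analysis.

Set Implicit Arguments.
Unset Strict Implicit.
Unset Printing Implicit Defensive.

Import Order.TTheory GRing.Theory Num.Theory.
Import numFieldNormedType.Exports.
Local Open Scope classical_set_scope.
Local Open Scope ring_scope.

(* [Num.int_num_subdef] is the predicate underlying [Num.int]; it is the one
   that carries the closure instances. *)
Definition int_subgroup (R : realType) : zmodClosed R :=
  (@Num.int_num_subdef R : {pred R}).

Definition circle (R : realType) : zmodType := Quotient.quot (int_subgroup R).

Definition torus (R : realType) : zmodType := (circle R * circle R)%type.

Definition toCircle (R : realType) (x : R) : circle R :=
  \pi_(Quotient.quot (int_subgroup R))%qT x.

Definition toTorus (R : realType) (p : R * R) : torus R :=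
  (toCircle p.1, toCircle p.2).

(* The preimage of [u] is a translate of the lattice Z^2, so the infimum is
   attained; the norm of [R * R] is the sup norm. *)
Definition torus_norm (R : realType) (u : torus R) : R :=
  inf [set `|p| | p in @toTorus R @^-1` [set u]].

Definition dilate (R : realType) (a b : int) (Y : set (torus R)) :
  set (torus R) := [set (y.1 *~ a, y.2 *~ b) | y in Y].

Definition eps_dense (R : realType) (e : R) (Z : set (torus R)) : Prop :=
  forall alpha : torus R, exists2 z, Z z & torus_norm (alpha - z) <= e.

Definition constant_poly (R : realType) (p : {poly R}) : Prop :=
  exists c : R, p = c%:P.

Definition no_constant_combination (R : realType) (P1 P2 : {poly int}) : Prop :=
  forall c1 c2 : R, (c1, c2) <> (0, 0) ->
    ~ constant_poly (c1 *: map_poly intr P1 + c2 *: map_poly intr P2).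

(* Main.v *)
From HB Require Import structures.
Require Import Defs.
From mathcomp Require Import all_boot all_order all_algebra.
From mathcomp Require Import all_classical all_reals all_analysis.
From mathcomp Require Import ring lra zify.

Import Order.TTheory GRing.Theory Num.Theory.
Import numFieldNormedType.Exports.
Local Open Scope classical_set_scope.
Local Open Scope ring_scope.

Set Implicit Arguments.
Unset Strict Implicit.
Unset Printing Implicit Defensive.

(** The first assertion is the second one for the polynomials X and X^2.

For the second, the argument is a second moment computation. If the dilate of
Y by (P1(n), P2(n)) misses a ball of radius e, then so does the dilate of any k
points of Y. A trigonometric kernel on the torus that is small off that ball
but has a large mean then detects the gap: one of finitely many nonzero
frequencies m = (m1, m2), depending only on e, has an exponential sum over the
k points of size comparable with k. So the sum over these m of
  |sum_i exp(2 i pi (m1 P1(n) u_i + m2 P2(n) w_i))|^2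
is at least a constant times k^2 ([large_energy_of_small_kernel]), where
(u_i, w_i) are real representatives of the points. If this happens for every
n > 0, it persists after averaging over n.

Expanding the square, the average over n is a sum over pairs (i, j) of means of
exponentials of the polynomial
  f = m1 (u_i - u_j) P1 + m2 (w_i - w_j) P2.
Pairs with i = j contribute only k. A qualitative form of Weyl's theorem
([weyl_dichotomy]) says that the mean for a polynomial f of bounded degree is
at most eta unless Q f has integral nonconstant coefficients, with Q depending
only on the degree and on eta. Independence of 1, P1 and P2 yields two
nonconstant coefficients with a nonzero minor, so Cramer's rule turns
integrality of Q f into: a fixed multiple N (u_i - u_j) or N (w_i - w_j) is an
integer ([correlation_small]). Since N-torsion is finite and the projections
are injective on Y, the k points can be picked so that this never happens
([separated_points]). The average is then at most a constant times
k + eta k^2, a contradiction for k large and eta small.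

Only real numbers are used: |sum_i exp(2 i pi x_i)|^2 is the double sum of the
cosines of 2 pi (x_i - x_j), called the energy of the family x below. *)

(** * Upper means of sequences *)

Section Mean.
Variable R : realType.
Implicit Types (u v w : nat -> R) (c d : R).

(** The limit superior of the absolute Cesaro means of [u] is at most [c]. The
slack [d] makes the notion exactly subadditive and invariant under shifts, so
that no boundary terms appear later. *)
Definition mean_le u c := forall d, 0 < d ->
  \forall N \near \oo, `|\sum_(n < N) u n| <= (c + d) * N%:R.

Lemma mean_le_trans u c c' : c <= c' -> mean_le u c -> mean_le u c'.
Proof.
move=> cc' uc d /uc; apply: filterS => N /le_trans; apply.
by rewrite ler_wpM2r// lerD2r.
Qed.

Lemma mean_le_eq u v c : u =1 v -> mean_le u c -> mean_le v c.
Proof. by move=> /funext ->. Qed.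

Lemma mean_leD u v c d :
  mean_le u c -> mean_le v d -> mean_le (fun n => u n + v n) (c + d).
Proof.
move=> uc vd e e0; have e20 : 0 < e / 2 by rewrite divr_gt0.
apply: filterS2 (uc _ e20) (vd _ e20) => N uN vN.
rewrite big_split/= (le_trans (ler_normD _ _))//.
by rewrite (le_trans (lerD uN vN))//; lra.
Qed.

Lemma mean_leZ u c a : mean_le u c -> mean_le (fun n => a * u n) (`|a| * c).
Proof.
move=> uc e e0.
have e1 : 0 < e / (`|a| + 1) by rewrite divr_gt0// ltr_wpDl.
apply: filterS (uc _ e1) => N uN.
rewrite -mulr_sumr normrM (le_trans (ler_wpM2l _ uN))//.
rewrite mulrA ler_wpM2r// mulrDr lerD2l mulrCA ger_pMr//.
by rewrite ler_pdivrMr ?mul1r ?ltr_wpDl// lerDl.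
Qed.

Lemma mean_le_cst a : mean_le (fun=> a) `|a|.
Proof.
move=> e e0; apply: nearW => N.
by rewrite sumr_const card_ord -[a *+ N]mulr_natr normrM normr_nat ler_wpM2r// lerDl ltW.
Qed.

Lemma mean_le_sum (I : Type) (r : seq I) (P : pred I) (u : I -> nat -> R)
    (c : I -> R) :
  (forall i, P i -> mean_le (u i) (c i)) ->
  mean_le (fun n => \sum_(i <- r | P i) u i n) (\sum_(i <- r | P i) c i).
Proof.
move=> uc; elim: r => [|i r IH].
  rewrite big_nil; have := @mean_le_cst 0; rewrite normr0.
  by apply: mean_le_eq => n; rewrite big_nil.
rewrite big_cons; case: ifPn => Pi; last first.
  by apply: mean_le_eq IH => n; rewrite big_cons (negbTE Pi).
by apply: mean_le_eq (mean_leD (uc _ Pi) IH) => n; rewrite big_cons Pi.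
Qed.

Lemma mean_le_dom u v c : (forall n, `|u n| <= v n) -> mean_le v c -> mean_le u c.
Proof.
move=> uv vc d /vc; apply: filterS => N vN.
rewrite (le_trans (ler_norm_sum _ _ _))// (le_trans _ vN)//.
by rewrite (le_trans _ (ler_norm _))// ler_sum.
Qed.

(** The sum telescopes: at most [2 * q] terms survive, whatever [N]. *)
Lemma mean_le_coboundary u b q : (forall n, `|u n| <= b) ->
  mean_le (fun n => u (n + q)%N - u n) 0.
Proof.
move=> ub d d0; rewrite add0r.
have telescope N : \sum_(n < N) (u (n + q)%N - u n) =
    \sum_(n < q) u (N + n)%N - \sum_(n < q) u n.
  have splitE M M' :
      \sum_(n < M + M') u n = \sum_(n < M) u n + \sum_(n < M') u (M + n)%N.
    by rewrite big_split_ord.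
  have := splitE N q; rewrite addnC splitE sumrB.
  under [in X in _ -> X]eq_bigr => i _ do rewrite addnC.
  by move=> E; lra.
near=> N.
rewrite telescope (le_trans (ler_normB _ _))//.
have bound (F : nat -> R) : (forall n, `|F n| <= b) -> `|\sum_(n < q) F n| <= q%:R * b.
  move=> Fb; rewrite (le_trans (ler_norm_sum _ _ _))//.
  rewrite (le_trans (ler_sum _ (fun (i : 'I_q) _ => Fb i)))// sumr_const card_ord.
  by rewrite mulr_natl.
rewrite (le_trans (lerD (bound (fun n => u (N + n)%N) _) (bound u _)))//.
rewrite -ler_pdivrMl//; near: N; exact: nbhs_infty_ger.
Unshelve. all: by end_near. Qed.

Lemma mean_le_shift u b c q : (forall n, `|u n| <= b) ->
  mean_le u c -> mean_le (fun n => u (n + q)%N) c.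
Proof.
move=> ub uc; rewrite -[c]addr0.
by apply: mean_le_eq (mean_leD uc (mean_le_coboundary q ub)) => n; rewrite addrC subrK.
Qed.

End Mean.

(** * Exponential sums and van der Corput's inequality *)

Section Circle.
Variable R : realType.
Implicit Types (x y : R).

(** Cosine and sine of the circle R/Z, in the coordinate of period 1. *)
Definition ccos x : R := cos (2 * pi * x).
Definition csin x : R := sin (2 * pi * x).

Lemma ccos_max x : `|ccos x| <= 1. Proof. exact: cos_max. Qed.
Lemma csin_max x : `|csin x| <= 1. Proof. exact: sin_max. Qed.

Lemma ccos0 : ccos 0 = 1. Proof. by rewrite /ccos mulr0 cos0. Qed.

Lemma ccosB x y : ccos (x - y) = ccos x * ccos y + csin x * csin y.
Proof. by rewrite /ccos mulrBr cosB. Qed.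

Lemma csinE x : csin x = ccos (x - 4^-1).
Proof.
rewrite /ccos /csin -cosBpihalf; congr cos.
by rewrite mulrBr; congr (_ - _); field.
Qed.

Lemma ccos_int x y : x - y \is a Num.int -> ccos x = ccos y.
Proof.
move=> /intrP[m xy].
have {xy} -> : x = y + m%:~R by rewrite -xy addrC subrK.
have shiftn z n : ccos (z + n%:R) = ccos z.
  rewrite /ccos -[RHS](periodicn (@cosD2pi R) n) mulrDr; congr cos.
  by rewrite -[in RHS](mulr_natr _ n) -[in RHS](mulr_natr pi 2); ring.
case: m => n; first exact: shiftn.
by rewrite NegzE mulrNz -[LHS](shiftn _ n.+1) subrK.
Qed.

Lemma csin_int x y : x - y \is a Num.int -> csin x = csin y.
Proof. by move=> xy; rewrite !csinE; apply: ccos_int; rewrite opprD addrACA subrr addr0. Qed.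

(** The squared modulus of the exponential sum of the [f i]; see [energyE]. *)
Definition energy (I : finType) (f : I -> R) : R :=
  \sum_i \sum_j ccos (f i - f j).

Lemma energyE (I : finType) (f : I -> R) :
  energy f = (\sum_i ccos (f i)) ^+ 2 + (\sum_i csin (f i)) ^+ 2.
Proof.
rewrite !expr2 !mulr_suml -big_split; apply: eq_bigr => i _ /=.
by rewrite !mulr_sumr -big_split; apply: eq_bigr => j _ /=; rewrite ccosB.
Qed.

Lemma energy_ge0 (I : finType) (f : I -> R) : 0 <= energy f.
Proof. by rewrite energyE addr_ge0// sqr_ge0. Qed.

(** The square of the left-hand side is at most the energy, and
[2 * l * s <= s ^+ 2 + l ^+ 2]. This linear form, with [l] free, replaces the
Cauchy-Schwarz inequality: it passes to means and sums term by term. *)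
Lemma sum_ccos_le_energy (I : finType) (f : I -> R) l : 0 < l ->
  `|\sum_i ccos (f i)| <= (l^-1 * energy f + l) / 2.
Proof.
move=> l0; set s := \sum_i _.
have E : `|s| ^+ 2 <= energy f.
  by rewrite real_normK ?num_real// energyE lerDl sqr_ge0.
rewrite ler_pdivlMr//.
have -> : l^-1 * energy f + l = l^-1 * (energy f + l ^+ 2) by field; rewrite gt_eqF.
rewrite ler_pdivlMl//; have := sqr_ge0 (`|s| - l); nra.
Qed.

(** If [f] advances by a fixed nonintegral amount [b] modulo 1 over a period [q],
the exponential of [f] is multiplied by a constant other than 1 by the shift by
[q], so its mean vanishes. In real terms it is a coboundary: dividing by
[2 * sin (pi * b)] writes the cosine as an increment over the period [q]. *)
Lemma mean_ccos_drift (f : nat -> R) q b :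
  (forall n, f (n + q)%N - f n - b \is a Num.int) -> b \isn't a Num.int ->
  mean_le (fun n => ccos (f n)) 0.
Proof.
move=> fb bN; set r := b - (Num.floor b)%:~R.
have r0 : 0 < r.
  rewrite lt_neqAle subr_ge0 floor_le_tmp andbT eq_sym subr_eq0 eq_sym.
  by rewrite -intrEfloor.
have r1 : r < 1 by rewrite ltrBlDl -[1]/(1%:~R) -intrD floorD1_gt.
have s0 : 0 < sin (pi * r).
  by apply: sin_gt0_pi; rewrite mulr_gt0 ?pi_gt0// gtr_pMr ?pi_gt0.
have fr n : csin (f (n + q)%N - r / 2) = csin (f n + r / 2).
  apply: csin_int; have -> : f (n + q)%N - r / 2 - (f n + r / 2) =
    f (n + q)%N - f n - b + (Num.floor b)%:~R by rewrite /r; lra.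
  by rewrite rpredD// intr_int.
have key n : ccos (f n) = (2 * sin (pi * r))^-1 *
    (csin (f (n + q)%N - r / 2) - csin (f n - r / 2)).
  rewrite fr /csin /ccos (mulrDr (2 * pi)) (mulrBr (2 * pi)).
  have -> : 2 * pi * (r / 2) = pi * r by field.
  by rewrite sinD sinB; field; rewrite gt_eqF.
rewrite -(mulr0 `|(2 * sin (pi * r))^-1|).
apply: mean_le_eq (mean_leZ _ (mean_le_coboundary (b := 1) (u := fun n => csin (f n - r / 2)) q _)).
  by move=> n; rewrite -key.
by move=> n; exact: csin_max.
Qed.

(** The mean of [ccos (f n)] is also that of its average over the window
[n, n + H), and the latter is controlled by the energy of the window, whose mean
involves only the correlations at lags [h < H]; the diagonal contributes the
term [H^-1]. *)
Lemma van_der_corput (f : nat -> R) H d eta :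
  (0 < H)%N -> 0 <= d -> 0 < eta -> H%:R^-1 + d <= eta ^+ 2 ->
  (forall h, (0 < h < H)%N -> mean_le (fun n => ccos (f (n + h)%N - f n)) d) ->
  mean_le (fun n => ccos (f n)) eta.
Proof.
move=> H0 d0 eta0 Hd corr.
have HR : 0 < H%:R :> R by rewrite ltr0n.
have pair (h h' : 'I_H) : mean_le (fun n => ccos (f (n + h)%N - f (n + h')%N))
    ((h == h')%:R + d).
  have lag (i j : 'I_H) : (i < j)%N ->
      mean_le (fun n => ccos (f (n + j)%N - f (n + i)%N)) d.
    move=> ij; have hH : (0 < j - i < H)%N by have := ltn_ord j; lia.
    have := mean_le_shift i (fun n => ccos_max _) (corr _ hH).
    by apply: mean_le_eq => n; rewrite -addnA subnKC// ltnW.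
  case: (ltngtP h h') => [hh'|h'h|/val_inj ->].
  - rewrite -val_eqE ltn_eqF// add0r; apply: mean_le_eq (lag _ _ hh') => n.
    by rewrite /ccos -cosN -mulrN opprB.
  - by rewrite -val_eqE gtn_eqF// add0r; exact: lag.
  - rewrite eqxx; apply: (mean_le_trans (c := `|1|)); first by rewrite normr1 lerDl.
    by apply: mean_le_eq (mean_le_cst 1) => n; rewrite subrr ccos0.
have energy_mean : mean_le (fun n => energy (fun h : 'I_H => f (n + h)%N))
    (H%:R * (1 + H%:R * d)).
  have -> : H%:R * (1 + H%:R * d) =
      \sum_(h < H) \sum_(h' < H) ((h == h')%:R + d).
    rewrite (eq_bigr (fun=> 1 + H%:R * d)) => [|h _].
      by rewrite sumr_const card_ord mulr_natl.
    rewrite big_split/= sumr_const card_ord mulr_natl; congr (_ + _).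
    rewrite (bigD1 h)//= eqxx big1 ?addr0// => j jh.
    by rewrite eq_sym (negbTE jh).
  by apply: mean_le_sum => h _; apply: mean_le_sum => h' _; exact: pair.
have window : mean_le (fun n => \sum_(h < H) ccos (f (n + h)%N)) (H%:R * eta).
  set l := H%:R * eta; have l0 : 0 < l by rewrite mulr_gt0.
  have := mean_leZ (2^-1) (mean_leD (mean_leZ l^-1 energy_mean) (mean_le_cst l)).
  move=> /(mean_le_dom (u := fun n => \sum_(h < H) ccos (f (n + h)%N))) dom.
  apply: mean_le_trans (dom _) => [|n]; last first.
    by rewrite [leRHS]mulrC; exact: sum_ccos_le_energy.
  have l0' := ltW l0; rewrite !ger0_norm ?invr_ge0// ler_pdivrMl// -lerBrDr.
  rewrite ler_pdivrMl//.
  have -> : H%:R * (1 + H%:R * d) = H%:R ^+ 2 * (H%:R^-1 + d) by field; rewrite gt_eqF.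
  apply: (le_trans (ler_wpM2l _ Hd)); first exact: sqr_ge0.
  by rewrite /l; have -> : H%:R * eta * (2 * (H%:R * eta) - H%:R * eta) = H%:R ^+ 2 * eta ^+ 2 by ring.
have drift : mean_le (fun n => \sum_(h < H) (-1) * (ccos (f (n + h)%N) - ccos (f n))) 0.
  apply: (mean_le_trans (c := \sum_(h < H) `|-1| * 0)).
    by rewrite big1// => h _; rewrite mulr0.
  apply: mean_le_sum => h _; apply: mean_leZ.
  by apply: (@mean_le_coboundary _ (fun n => ccos (f n))) => n; exact: ccos_max.
have := mean_leZ (H%:R^-1) (mean_leD drift window).
rewrite add0r ger0_norm ?invr_ge0 ?ltW// mulKf ?gt_eqF//.
apply: mean_le_eq => n; rewrite -big_split/= (eq_bigr (fun=> ccos (f n))) => [|h _].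
  by rewrite sumr_const card_ord -[ccos _ *+ H]mulr_natl mulKf ?gt_eqF.
by ring.
Qed.

End Circle.

(** * A qualitative form of Weyl's theorem *)

Section Weyl.
Variable R : realType.
Implicit Types (f g : {poly R}).

Definition poly_diff (h : nat) f := f \Po ('X + h%:R%:P) - f.

Lemma horner_poly_diff h f n :
  (poly_diff h f).[n%:R] = f.[(n + h)%:R] - f.[n%:R].
Proof. by rewrite !hornerE horner_comp !hornerE natrD. Qed.

Lemma coef_poly_diff h f j : (poly_diff h f)`_j =
  \sum_(i < size f) f`_i * (h%:R ^+ (i - j) *+ 'C(i, j)) - f`_j.
Proof.
rewrite coefB coef_comp_poly; congr (_ - _); apply: eq_bigr => i _; congr (_ * _).
rewrite exprDn coef_sum; have [ji|ij] := leqP j i; last first.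
  rewrite bin_small// mulr0n big1// => k _.
  by rewrite coefMn -rmorphXn coefMC coefXn gtn_eqF ?mul0r ?mul0rn// (leq_ltn_trans _ ij)// leq_subr.
have kP : (i - j < i.+1)%N by rewrite ltnS leq_subr.
rewrite (bigD1 (Ordinal kP))//= subKn// big1 ?addr0 => [|k /eqP kij].
  by rewrite coefMn -rmorphXn coefMC coefXn eqxx mul1r bin_sub.
rewrite coefMn -rmorphXn coefMC coefXn; case: eqP => [jE|]; last by rewrite mul0r mul0rn.
by case: kij; apply: val_inj => /=; have := ltn_ord k; lia.
Qed.

Lemma poly_diff_coef_pred h f j : (0 < j < size f)%N ->
  (poly_diff h f)`_j.-1 = f`_j * (j * h)%:R +
    \sum_(i < size f | (j < i)%N) f`_i * (h%:R ^+ (i - j.-1) *+ 'C(i, j.-1)).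
Proof.
move=> /andP[j0 jf]; have j1f : (j.-1 < size f)%N by lia.
rewrite coef_poly_diff (bigID (fun i : 'I__ => (j < i)%N))/= [X in X - _]addrC -addrA addrC.
rewrite [X in _ + X](bigD1 (Ordinal jf)) ?ltnn//=.
rewrite [X in _ + (_ + X)](bigD1 (Ordinal j1f))/=; last first.
  by rewrite -leqNgt leq_pred -val_eqE/= neq_ltn ltn_predL j0.
set tail := \sum_(i < _ | (j < i)%N) _; rewrite big1 => [|i]; last first.
  rewrite -!val_eqE/= => /andP[/andP[ij i1] i2].
  by rewrite bin_small ?mulr0n ?mulr0//; lia.
have -> : (j - j.-1)%N = 1%N by lia.
have -> : 'C(j, j.-1) = j by have := binSn j.-1; rewrite prednK.
rewrite subnn binn natrM expr0 expr1 -mulr_natr; ring.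
Qed.

Lemma size_poly_diff h f d : (size f <= d.+1)%N -> (size (poly_diff h f) <= d)%N.
Proof.
move=> fd; apply/leq_sizeP => j dj; rewrite coef_poly_diff.
have [jf|fj] := ltnP j (size f); last first.
  rewrite [f`_j]nth_default// subr0 big1// => i _.
  by rewrite bin_small ?mulr0n ?mulr0// (leq_trans _ fj).
rewrite (bigD1 (Ordinal jf))//= subnn binn mulr1 addrAC subrr.
rewrite ?add0r big1// => i; rewrite -val_eqE/= => ij.
rewrite bin_small ?mulr0n ?mulr0// ltn_neqAle ij -ltnS.
by rewrite (leq_trans (ltn_ord i))// (leq_trans fd).
Qed.

(** The coefficient of degree [j - 1] of the difference is [j * h] times that of
degree [j] of [f], up to an integral combination of the coefficients of higher
degree. So integrality, at the cost of a factor [K] per degree, descends from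
the top coefficient; the constant coefficient of the difference is not
controlled, hence neither is the linear coefficient of [f]. *)
Lemma int_coef_of_poly_diff h f (Q K : nat) :
  (forall j, (0 < j)%N -> (poly_diff h f)`_j * Q%:R \is a Num.int) ->
  (forall j, (0 < j < size f)%N -> (j * h %| K)%N) ->
  forall t j, (1 < j)%N -> (size f <= j + t)%N ->
    f`_j * (Q * K ^ t)%:R \is a Num.int.
Proof.
move=> dfQ dvdK; elim=> [|t IH] j j1 fj.
  by rewrite nth_default ?mul0r ?rpred0// -[j]addn0.
have [jf|fj'] := ltnP j (size f); last by rewrite nth_default ?mul0r ?rpred0.
have j0 : (0 < j < size f)%N by lia.
have /dvdnP[c KE] := dvdK _ j0.
have -> : f`_j * (Q * K ^ t.+1)%:R =
    (f`_j * (j * h)%:R * (Q * K ^ t)%:R) * c%:R.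
  by rewrite expnS {1}KE -!mulrA -!natrM; congr (_ * _%:R); lia.
apply: rpredM; last exact: rpred_nat.
have := poly_diff_coef_pred h j0.
move=> /(congr1 (fun x => x - \sum_(i < size f | (j < i)%N)
  f`_i * (h%:R ^+ (i - j.-1) *+ 'C(i, j.-1)))); rewrite addrK => <-.
rewrite mulrBl rpredB//.
  by rewrite natrM mulrA rpredM ?rpred_nat// dfQ//; lia.
rewrite mulr_suml rpred_sum// => i ji; rewrite mulrAC rpredM//.
  by apply: IH; lia.
by rewrite rpredMn// rpredX// rpred_nat.
Qed.

Lemma int_horner_shift g (Q n : nat) :
  (forall j, (0 < j)%N -> g`_j * Q%:R \is a Num.int) ->
  g.[(n + Q)%:R] - g.[n%:R] \is a Num.int.
Proof.
move=> gQ; rewrite !horner_coef -sumrB rpred_sum// => -[[|j] jg] _ /=.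
  by rewrite !expr0 subrr.
rewrite -mulrBr subrXX natrD addrAC subrr add0r mulrA rpredM ?gQ//.
by rewrite rpred_sum// => i _; rewrite rpredM// rpredX// ?rpredD// rpred_nat.
Qed.

(** Induction on the degree. By van der Corput, if the mean for [f] is large then
so is that for the difference of [f] at some bounded step [h]; by induction the
coefficients of [f] of degree at least 2 are rational with bounded denominator
[Q]. Then [f (n + Q) - f n] is constant modulo 1, equal to [Q] times the linear
coefficient, and the mean vanishes unless that is an integer. *)
Theorem weyl_dichotomy d : forall eta : R, 0 < eta ->
  exists2 Q : nat, (0 < Q)%N & forall f, (size f <= d.+1)%N ->
    mean_le (fun n => ccos f.[n%:R]) eta \/
    (forall j, (0 < j)%N -> f`_j * Q%:R \is a Num.int).
Proof.
elim: d => [|d IH] eta eta0.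
  exists 1%N => // f f1; right=> j j0.
  by rewrite nth_default ?mul0r ?rpred0// (leq_trans f1).
(* [eta ^+ 2] is shared equally between [H^-1] and the correlations. *)
set e := eta ^+ 2 / 2; have e0 : 0 < e by rewrite divr_gt0// exprn_gt0.
have [Q' Q'0 weyl] := IH e e0.
have [H H0 He] : exists2 H : nat, (0 < H)%N & H%:R^-1 <= e.
  exists (Num.trunc e^-1).+1 => //.
  by rewrite invf_ple ?posrE// ltW// truncnS_gt.
pose K := ((d.+1)`! * H`!)%N.
have K0 : (0 < K)%N by rewrite muln_gt0 !fact_gt0.
exists (Q' * K ^ d.+2)%N => [|f fd]; first by rewrite muln_gt0 Q'0 expn_gt0 K0.
have [corr|/existsNP[h /not_implyP[/andP[h0 hH] ncorr]]] :=
    pselect (forall h, (0 < h < H)%N ->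
      mean_le (fun n => ccos (f.[(n + h)%:R] - f.[n%:R])) e).
  left; apply: (van_der_corput H0 (ltW e0) eta0 _ corr).
  by rewrite (le_trans (lerD He (lexx _)))// /e; lra.
have [corr|dQ] := weyl _ (size_poly_diff h fd).
  by case: ncorr; apply: mean_le_eq corr => n; rewrite horner_poly_diff.
have high j : (1 < j)%N -> f`_j * (Q' * K ^ d.+2)%:R \is a Num.int.
  move=> j1; apply: (int_coef_of_poly_diff dQ) => //; last by lia.
  move=> i /andP[i0 isz]; apply: dvdn_mul.
    by rewrite dvdn_fact// i0/=; lia.
  by rewrite dvdn_fact// h0 ltnW.
set Q := (Q' * K ^ d.+2)%N.
have [f1|f1] := boolP (f`_1 * Q%:R \is a Num.int).
  by right=> -[|[|j]]// _; exact: high.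
left; apply: mean_le_trans (ltW eta0) _.
apply: (mean_ccos_drift (f := fun n => f.[n%:R]) (q := Q) _ f1) => n.
(* Removing the linear term leaves a polynomial that is [Q]-periodic modulo 1. *)
pose g := f - f`_1 *: 'X.
have -> : f.[(n + Q)%:R] - f.[n%:R] - f`_1 * Q%:R = g.[(n + Q)%:R] - g.[n%:R].
  by rewrite /g !hornerE natrD; ring.
apply: int_horner_shift => -[|[|j]]// _; rewrite coefB coefZ coefX/=.
  by rewrite mulr1 subrr mul0r rpred0.
by rewrite mulr0 subr0; exact: high.
Qed.

End Weyl.

(** * Kernels detecting gaps *)

Section Kernel.
Variable R : realType.
Implicit Types (x y c : R).

Lemma energyD (I J : finType) (f : I -> R) (g : J -> R) :
  energy (fun p : I * J => f p.1 + g p.2) = energy f * energy g.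
Proof.
have ccosD x y : ccos (x + y) = ccos x * ccos y - csin x * csin y.
  by rewrite /ccos mulrDr cosD.
have csinD x y : csin (x + y) = csin x * ccos y + ccos x * csin y.
  by rewrite /csin mulrDr sinD.
have sumM (F : I -> R) (G : J -> R) :
    \sum_(p : I * J) F p.1 * G p.2 = (\sum_i F i) * (\sum_j G j).
  by rewrite mulr_suml; under [RHS]eq_bigr do rewrite mulr_sumr; rewrite pair_big.
rewrite !energyE; under eq_bigr do rewrite ccosD.
under [X in _ + X ^+ 2]eq_bigr do rewrite csinD.
rewrite big_split/= sumrN big_split/=.
rewrite (sumM (fun i => ccos (f i)) (fun j => ccos (g j))).
rewrite (sumM (fun i => csin (f i)) (fun j => csin (g j))).
rewrite (sumM (fun i => csin (f i)) (fun j => ccos (g j))).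
by rewrite (sumM (fun i => ccos (f i)) (fun j => csin (g j))); ring.
Qed.

Lemma energy_le_card (I : finType) (f : I -> R) : energy f <= #|I|%:R ^+ 2.
Proof.
rewrite expr2 -[X in X * _]mulr1 -mulrA mulr_natl -sumr_const ler_sum// => i _.
rewrite mul1r -[leRHS]mulr1 mulr_natl -sumr_const ler_sum// => j _.
exact: le_trans (ler_norm _) (ccos_max _).
Qed.

Lemma energyB (I : finType) (f : I -> R) c : energy (fun i => f i - c) = energy f.
Proof.
by apply: eq_bigr => i _; apply: eq_bigr => j _; rewrite opprB addrA subrK.
Qed.

(** Multiplying by [2 * sin (pi * x)] makes the sum telescope. The phase [c]
covers the sine sum as well. *)
Lemma dirichlet_sum_le L x c (s : R) : 0 < s -> s <= `|sin (pi * x)| ->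
  `|\sum_(a < L) ccos (x * a%:R + c)| <= s^-1.
Proof.
move=> s0 sx; have sx0 : 0 < `|sin (pi * x)| by exact: lt_le_trans sx.
apply: le_trans (_ : `|sin (pi * x)|^-1 <= _); last by rewrite lef_pV2.
pose w (a : nat) := csin (x * a%:R + c - x / 2).
have -> : \sum_(a < L) ccos (x * a%:R + c) = (2 * sin (pi * x))^-1 * (w L - w 0%N).
  rewrite -telescope_sumr// big_mkord mulr_sumr; apply: eq_bigr => a _.
  rewrite /w; have -> : x * a.+1%:R + c - x / 2 = x * a%:R + c + x / 2.
    by rewrite -addn1 natrD; lra.
  move: (x * a%:R + c) => y; rewrite /csin /ccos (mulrDr (2 * pi)) (mulrBr (2 * pi)).
  have -> : 2 * pi * (x / 2) = pi * x by field.
  by rewrite sinD sinB; field; rewrite -normr_gt0.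
rewrite normrM normfV normrM invfM [_^-1 * _^-1]mulrC -mulrA.
rewrite ger_pMr ?invr_gt0// (@ger0_norm _ 2)// ler_pdivrMl// mulr1.
by rewrite (le_trans (ler_normB _ _))// (natrD _ 1 1) lerD// csin_max.
Qed.

Lemma fejer_le L x (s : R) : 0 < s -> s <= `|sin (pi * x)| ->
  energy (fun a : 'I_L => x * a%:R) <= 2 * s ^- 2.
Proof.
move=> s0 sx; have sqr_le y : `|y| <= s^-1 -> y ^+ 2 <= s ^- 2.
  by move=> ys; rewrite -[leLHS]real_normK ?num_real// -exprVn lerXn2r// nnegrE invr_ge0 ltW.
rewrite energyE mulrDl mul1r lerD// sqr_le//.
  have := dirichlet_sum_le L 0 s0 sx.
  by under eq_bigr do rewrite addr0.
have := dirichlet_sum_le L (- 4^-1) s0 sx.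
by under eq_bigr do rewrite -csinE.
Qed.

(** Expanding the kernel, an energy over [S] of phases linear in the point, and
summing over the points [x i], each pair of [S] with equal frequencies
contributes [#|I|], which beats the assumed bound [B] on the kernel. The other
pairs must therefore cancel at least [#|I|], so that some exponential sums over
the points are large. The centre [al] of the ball only shifts phases and
disappears from the energies. *)
Lemma large_energy_of_small_kernel (I S : finType) (p q : S -> nat) (x : I -> R * R) (al : R * R) B :
  (0 < #|I|)%N ->
  (forall i, energy (fun s : S => (p s)%:R * ((x i).1 - al.1) + (q s)%:R * ((x i).2 - al.2)) <= B) ->
  B + 1 <= #|[pred r : S * S | (p r.1 == p r.2) && (q r.1 == q r.2)]|%:R ->
  #|I|%:R ^+ 2 / #|S|%:R ^+ 2 <=
  \sum_(r : S * S | ~~ ((p r.1 == p r.2) && (q r.1 == q r.2)))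
     energy (fun i => ((p r.1)%:R - (p r.2)%:R) * (x i).1 +
                      ((q r.1)%:R - (q r.2)%:R) * (x i).2).
Proof.
move=> I0 small diagB.
set diag := fun r : S * S => (p r.1 == p r.2) && (q r.1 == q r.2).
pose psi (r : S * S) i := ((p r.1)%:R - (p r.2)%:R) * (x i).1 +
                          ((q r.1)%:R - (q r.2)%:R) * (x i).2.
pose cst (r : S * S) := ((p r.1)%:R - (p r.2)%:R) * al.1 +
                        ((q r.1)%:R - (q r.2)%:R) * al.2.
set W := \sum_(r | _) _; set k : R := #|I|%:R; set M : R := #|S|%:R.
have k0 : 0 < k by rewrite ltr0n.
have total : \sum_(r : S * S) \sum_i ccos (psi r i - cst r) <= k * B.
  rewrite exchange_big/= mulr_natl -sumr_const ler_sum// => i _.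
  apply: le_trans (small i); rewrite -(pair_big xpredT xpredT
    (fun s t : S => ccos (psi (s, t) i - cst (s, t))))/=.
  apply: ler_sum => s _; apply: ler_sum => t _.
  by rewrite le_eqVlt; apply/orP; left; apply/eqP; congr ccos; rewrite /psi /cst/=; ring.
have S0 : 0 < M.
  have [i _] := card_gt0P I0.
  have B0 : 0 <= B := le_trans (energy_ge0 _) (small i).
  have : 0 < #|[pred r | diag r]|%:R :> R by apply: lt_le_trans diagB; rewrite ltr_wpDl.
  rewrite !ltr0n => /leq_trans/(_ (max_card _)).
  by rewrite card_prod muln_gt0 => /andP[].
set l := k / M ^+ 2; have l0 : 0 < l by rewrite divr_gt0// exprn_gt0.
have diag_part : \sum_(r | diag r) \sum_i ccos (psi r i - cst r) =
    k * #|[pred r | diag r]|%:R.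
  rewrite (eq_bigr (fun=> k)) => [|r /andP[/eqP pr /eqP qr]]; last first.
    rewrite (eq_bigr (fun=> 1)) ?sumr_const// => i _.
    by rewrite /psi /cst pr qr !subrr !mul0r addr0 subrr ccos0.
  by rewrite sumr_const mulr_natr.
have off_part : - ((l^-1 * W + l * M ^+ 2) / 2) <=
    \sum_(r | ~~ diag r) \sum_i ccos (psi r i - cst r).
  rewrite lerNl -sumrN; apply: (@le_trans _ _
      (\sum_(r | ~~ diag r) (l^-1 * energy (psi r) + l) / 2)).
    apply: ler_sum => r _; rewrite -(energyB (psi r) (cst r)).
    by apply: le_trans (sum_ccos_le_energy _ l0); rewrite -normrN ler_norm.
  rewrite -mulr_suml ler_pM2r ?invr_gt0// big_split/= -mulr_sumr lerD2l.
  rewrite sumr_const -[l *+ _]mulr_natr ler_pM2l// /M -natrX ler_nat.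
  by rewrite (leq_trans (max_card _))// card_prod expnS expn1.
move: total; rewrite (bigID diag)/= diag_part => total.
have {}total : k * (B + 1) - (l^-1 * W + l * M ^+ 2) / 2 <= k * B.
  apply: le_trans total; rewrite lerD// ler_pM2l//.
have lM : l * M ^+ 2 = k by rewrite /l divfK// expf_neq0// gt_eqF.
have : k <= l^-1 * W by rewrite lM in total; lra.
by rewrite ler_pdivlMl// /l expr2 mulrAC.
Qed.

End Kernel.

Section Lattice.
Variable R : realType.

(** The kernel is the square of a product of two Fejer kernels: an energy over
quadruples, with frequencies [freq1] and [freq2]. Squaring is what makes it
work in dimension 2: far from 0 in one coordinate, a product of two Fejer
kernels is only O(L^2), of the order of its mean, whereas its square is
O(L^4) with mean of order L^6. *)
Definition box L : finType := (('I_L * 'I_L) * ('I_L * 'I_L))%type.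
Definition freq1 L (s : box L) : nat := (s.1.1 + s.1.2)%N.
Definition freq2 L (s : box L) : nat := (s.2.1 + s.2.2)%N.

Lemma card_box L : #|box L| = (L ^ 4)%N.
Proof. by rewrite !card_prod card_ord; ring. Qed.

Lemma kernel_le L (z1 z2 s : R) : 0 < s ->
  s <= `|sin (pi * z1)| \/ s <= `|sin (pi * z2)| ->
  energy (fun b : box L => (freq1 b)%:R * z1 + (freq2 b)%:R * z2) <=
  (2 * s ^- 2) ^+ 2 * L%:R ^+ 4.
Proof.
move=> s0 far.
pose K (z : R) := energy (fun a : 'I_L => z * a%:R).
have K_ge0 z : 0 <= K z by exact: energy_ge0.
have K_le z : K z <= L%:R ^+ 2 by rewrite (le_trans (energy_le_card _))// card_ord.
have -> : energy (fun b : box L => (freq1 b)%:R * z1 + (freq2 b)%:R * z2) =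
    K z1 ^+ 2 * K z2 ^+ 2.
  rewrite !expr2 /K -!energyD; apply: eq_bigr => b _; apply: eq_bigr => b' _.
  by congr ccos; rewrite /freq1 /freq2 !natrD; ring.
have -> : L%:R ^+ 4 = (L%:R ^+ 2) ^+ 2 :> R by rewrite -exprM.
have sqr_le z B : K z <= B -> K z ^+ 2 <= B ^+ 2.
  by move=> KB; rewrite lerXn2r ?nnegrE ?(le_trans _ KB).
case: far => /(fejer_le L s0) far; last rewrite mulrC.
  by rewrite ler_pM ?sqr_ge0 ?sqr_le.
by rewrite ler_pM ?sqr_ge0 ?sqr_le.
Qed.

(** The identity [a + (b + c) = (a + b) + c] provides the pairs with equal
frequencies: [a], [c] and [b + c] determine the triple. *)
Lemma card_diag_box l :
  (l ^ 6 <= #|[pred r : box (l + l) * box (l + l) |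
     (freq1 r.1 == freq1 r.2) && (freq2 r.1 == freq2 r.2)]|)%N.
Proof.
have addP (a b : 'I_l) : (a + b < l + l)%N by rewrite -addnS leq_add// ltnW.
pose add a b : 'I_(l + l) := Ordinal (addP a b).
pose inj (a : 'I_l) : 'I_(l + l) := widen_ord (leq_addr l l) a.
pose I3 : finType := ('I_l * 'I_l * 'I_l)%type.
pose g (t : I3 * I3) : box (l + l) * box (l + l) :=
  let: ((a, b, c), (a', b', c')) := t in
  (((inj a, add b c), (inj a', add b' c')), ((add a b, inj c), (add a' b', inj c'))).
have g_inj : injective g.
  move=> [[[a b] c] [[a' b'] c']] [[[u v] w] [[u' v'] w']] [] /=.
  move=> au bc au' bc' ab cw ab' cw'.
  have [bE b'E] : b = v /\ b' = v' by split; apply: val_inj => /=; lia.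
  by rewrite bE b'E (val_inj au) (val_inj au') (val_inj cw) (val_inj cw').
rewrite (_ : l ^ 6 = #|{: I3 * I3}|)%N; last by rewrite !card_prod card_ord; ring.
rewrite -(fintype.card_image g_inj); apply/subset_leq_card/fintype.subsetP => r /fintype.imageP[t _ ->].
case: t => [[[a b] c] [[a' b'] c']]; rewrite inE /freq1 /freq2/=.
by rewrite !addnA !eqxx.
Qed.

End Lattice.

(** * The torus *)

Section Torus.
Variable R : realType.
Implicit Types (x e : R) (Y : set (torus R)).

(** By periodicity [x] may be reduced to the interval from -1/2 to 1/2, where
[sin (pi * x)] is increasing. *)
Lemma near_int_of_sin x e : 0 < e -> e <= 2^-1 ->
  `|sin (pi * x)| < sin (pi * e) -> exists m : int, `|x - m%:~R| <= e.
Proof.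
move=> e0 e2 small; exists (Num.floor (x + 2^-1)).
set m := Num.floor _; set w := x - m%:~R.
rewrite leNgt; apply/negP => ew.
have sin_sqr (y : R) : sin (pi * y) ^+ 2 = (1 - ccos y) / 2.
  by rewrite /ccos -[X in X * pi]/(1 *+ 2) mulrnAl mul1r mulrnAl cos_mulr2n cos2sin2; field.
have normE : `|sin (pi * x)| = `|sin (pi * w)|.
  rewrite -!sqrtr_sqr !sin_sqr; congr (Num.sqrt ((1 - _) / 2)).
  by apply: ccos_int; rewrite /w opprB addrC subrK intr_int.
have wle : `|w| <= 2^-1.
  have := floor_le_tmp (x + 2^-1); have := floorD1_gt (x + 2^-1).
  rewrite -/m intrD ler_norml /w => *; apply/andP; split; lra.
have mono y : e < y -> y <= 2^-1 -> sin (pi * e) < sin (pi * y).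
  have pi0 := pi_gt0 R.
  move=> ey y2; rewrite ltr_sin ?ltr_pM2l// in_itv/=; apply/andP; split; nra.
move: small; rewrite normE ltNge => /negP; apply.
have [w0|w0] := leP 0 w.
  by rewrite (le_trans _ (ler_norm _))// ltW// mono// -(ger0_norm w0).
rewrite -normrN -sinN -mulrN (le_trans _ (ler_norm _))// ltW// mono//.
  by rewrite -ltr0_norm.
by rewrite -ltr0_norm.
Qed.

Lemma toCircle_is_zmod_morphism : zmod_morphism (@toCircle R).
Proof. exact: raddfB. Qed.
HB.instance Definition _ := GRing.isZmodMorphism.Build R (circle R) (@toCircle R)
  toCircle_is_zmod_morphism.

Lemma toCircle_eq0 x : (toCircle x == 0) = (x \is a Num.int).
Proof.
rewrite -(raddf0 (@toCircle R)) /toCircle -Quotient.idealrBE subr0.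
by [].
Qed.

Lemma toCircle_surj (c : circle R) : exists x, c = toCircle x.
Proof. by exists (repr c); rewrite /toCircle reprK. Qed.

Lemma torus_norm_le (p : R * R) : torus_norm (toTorus p) <= `|p|.
Proof.
apply: ge_inf; last by exists p.
by exists 0 => _ [p' _ <-]; exact: normr_ge0.
Qed.

Lemma eps_dense_le e e' (Z : set (torus R)) : e <= e' -> eps_dense e Z -> eps_dense e' Z.
Proof. by move=> ee' Ze al; have [z Zz zal] := Ze al; exists z => //; apply: le_trans ee'. Qed.

Lemma not_eps_dense Y a b e : 0 < e -> e <= 2^-1 -> ~ eps_dense e (dilate a b Y) ->
  exists al : R * R, forall p : R * R, Y (toTorus p) ->
    sin (pi * e) <= `|sin (pi * (a%:~R * p.1 - al.1))| \/
    sin (pi * e) <= `|sin (pi * (b%:~R * p.2 - al.2))|.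
Proof.
move=> e0 e2 /existsNP[[c1 c2] nal].
have [al1 c1E] := toCircle_surj c1; have [al2 c2E] := toCircle_surj c2.
exists (al1, al2) => -[u w] Yuw /=.
have [|s1] := leP (sin (pi * e)) _; first by left.
have [|s2] := leP (sin (pi * e)) _; first by right.
have [m1 m1e] := near_int_of_sin e0 e2 s1.
have [m2 m2e] := near_int_of_sin e0 e2 s2.
case: nal; exists (toCircle u *~ a, toCircle w *~ b).
  by exists (toTorus (u, w)).
have -> : (c1, c2) - (toCircle u *~ a, toCircle w *~ b) =
    toTorus (- (a%:~R * u - al1 - m1%:~R), - (b%:~R * w - al2 - m2%:~R)).
  have int0 (m : int) : toCircle (m%:~R : R) = 0.
    by apply/eqP; rewrite toCircle_eq0 intr_int.
  rewrite /toTorus/= !raddfN !raddfB/= !int0 !oppr0 !addr0 !opprK !mulrzl !raddfMz/=.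
  rewrite -[LHS]/(c1 - toCircle u *~ a, c2 - toCircle w *~ b) c1E c2E.
  by rewrite !mulNrz; congr pair; exact: addrC.
apply: le_trans (torus_norm_le _) _.
by rewrite prod_normE/= ge_max !normrN m1e m2e.
Qed.

End Torus.

Section Selection.
Variable R : realType.
Implicit Types (Y : set (torus R)).

(** Every solution is [a + t / N] with [0 <= t < N]. *)
Lemma finite_torsion (N : nat) (a : circle R) : (0 < N)%N ->
  finite_set [set c : circle R | (c - a) *+ N = 0].
Proof.
move=> N0; have NR : N%:R != 0 :> R by rewrite pnatr_eq0 -lt0n.
apply: (@sub_finite_set _ _ ((fun t : nat => a + toCircle (t%:R / N%:R)) @` `I_N)); last first.
  exact: finite_image.
move=> c /= caN; have [z zE] := toCircle_surj (c - a).
move: caN; rewrite zE -raddfMn => /eqP; rewrite toCircle_eq0 => /intrP[m zm].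
exists `|(m %% N)%Z|%N => /=.
  by rewrite -ltz_nat gez0_abs ?modz_ge0 ?ltz_pmod// -lt0n.
rewrite -[c](subrK a) zE addrC; congr (_ + _).
apply/eqP; rewrite -subr_eq0 -raddfB toCircle_eq0.
rewrite -[_%:R]/((Posz _)%:~R) gez0_abs ?modz_ge0 -?lt0n//.
have zE' : z = (m %/ N)%Z%:~R + (m %% N)%Z%:~R / N%:R.
  by apply: (mulIf NR); rewrite mulrDl divfK// mulr_natr zm {1}(divz_eq m N) intrD intrM.
suff -> : (m %% N)%Z%:~R / N%:R - z = - ((m %/ N)%Z)%:~R by rewrite rpredN intr_int.
by rewrite zE'; ring.
Qed.

Lemma finite_torsion_fiber Y (f : torus R -> circle R) (N : nat) a : (0 < N)%N ->
  (forall y z, Y y -> Y z -> f y = f z -> y = z) ->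
  finite_set (Y `&` [set y | (f y - a) *+ N = 0]).
Proof.
move=> N0 f_inj; set A := _ `&` _.
have fA : {in A &, injective f}.
  by move=> y z /set_mem[Yy _] /set_mem[Yz _]; exact: f_inj.
rewrite -(eq_finite_set (inj_card_eq fA)).
apply: sub_finite_set (finite_torsion a N0).
by move=> _ [y [_ yA] <-].
Qed.

(** Greedy choice: as the projections are injective, each point already chosen
excludes finitely many points of [Y]. *)
Lemma separated_points Y (N : nat) k : (0 < N)%N -> infinite_set Y ->
  (forall y z : torus R, Y y -> Y z -> y.1 = z.1 -> y = z) ->
  (forall y z : torus R, Y y -> Y z -> y.2 = z.2 -> y = z) ->
  exists x : 'I_k -> R * R, (forall i, Y (toTorus (x i))) /\
    forall i j, i != j -> ((x i).1 - (x j).1) * N%:R \isn't a Num.int /\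
                          ((x i).2 - (x j).2) * N%:R \isn't a Num.int.
Proof.
move=> N0 Yinf inj1 inj2; elim: k => [|k [x [xY xsep]]].
  by exists (fun=> 0); split => [[]|[]].
pose bad i := (Y `&` [set y | (y.1 - toCircle (x i).1) *+ N = 0]) `|`
              (Y `&` [set y | (y.2 - toCircle (x i).2) *+ N = 0]).
have bad_fin : finite_set (\bigcup_(i in [set: 'I_k]) bad i).
  apply: bigcup_finite => // i _; rewrite finite_setU.
  by split; [exact: (finite_torsion_fiber _ N0 inj1)|exact: (finite_torsion_fiber _ N0 inj2)].
have [[c1 c2] [Yc good]] := infinite_setN0 (infinite_setD Yinf bad_fin).
have [u uE] := toCircle_surj c1; have [w wE] := toCircle_surj c2.
have new i : (u - (x i).1) * N%:R \isn't a Num.int /\ (w - (x i).2) * N%:R \isn't a Num.int.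
  split; apply/negP => isint; apply: good; exists i => //; [left|right]; split=> //=.
    by apply/eqP; rewrite uE -raddfB -raddfMn toCircle_eq0 -mulr_natr.
  by apply/eqP; rewrite wE -raddfB -raddfMn toCircle_eq0 -mulr_natr.
have opp (s t : R) : (s - t) * N%:R \isn't a Num.int -> (t - s) * N%:R \isn't a Num.int.
  by rewrite -opprB mulNr rpredN.
exists (fun i => if unlift ord0 i is Some j then x j else (u, w)); split=> [i|i j].
  case: unliftP => [j _|_]; first exact: xY.
  by rewrite /toTorus/= -uE -wE.
case: unliftP => [i' ->|->]; case: unliftP => [j' ->|->] ij.
- by apply: xsep; apply: contraNneq ij => ->.
- by have [] := new i'; split; exact: opp.
- exact: new.
- by rewrite eqxx in ij.
Qed.

End Selection.

(** * The second moment argument *)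

Section Main.
Variable R : realType.

(** If all the minors vanish, then either the nonconstant coefficients of [P1] are
all zero, or for [P1`_i != 0] the combination [P2`_i P1 - P1`_i P2] is
constant. *)
Lemma independent_coefs (P1 P2 : {poly int}) : no_constant_combination R P1 P2 ->
  exists i j, [/\ (0 < i)%N, (0 < j)%N & P1`_i * P2`_j - P1`_j * P2`_i != 0].
Proof.
move=> indep; apply/not_existsP => minors.
have {}minors i j : (0 < i)%N -> (0 < j)%N -> P1`_i * P2`_j = P1`_j * P2`_i.
  move=> i0 j0; apply/eqP; rewrite -subr_eq0; apply/negPn/negP => ij.
  by apply: (minors i); exists j.
have constP (c1 c2 : R) : (forall j, (0 < j)%N -> c1 * (P1`_j)%:~R + c2 * (P2`_j)%:~R = 0) ->
    constant_poly (c1 *: map_poly intr P1 + c2 *: map_poly intr P2).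
  move=> c0; exists (c1 * (P1`_0)%:~R + c2 * (P2`_0)%:~R); apply/polyP => j.
  rewrite coefD !coefZ !coef_map coefC; case: j => [|j]//=; exact: c0.
have [P10|/existsNP[i /not_implyP[i0 /eqP P1i]]] :=
    pselect (forall i, (0 < i)%N -> P1`_i = 0).
  apply: (indep 1 0) => [[/eqP]|]; first by rewrite oner_eq0.
  by apply: constP => j j0; rewrite P10// mulr0 mul0r addr0.
apply: (indep (P2`_i)%:~R (- (P1`_i)%:~R)) => [[_ /eqP]|].
  by rewrite oppr_eq0 intr_eq0 (negbTE P1i).
by apply: constP => j j0; rewrite mulNr -!intrM minors// mulrC subrr.
Qed.

Lemma horner_map_intr (P : {poly int}) (n : nat) :
  (map_poly intr P).[n%:R] = (P.[n%:Z])%:~R :> R.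
Proof. by rewrite -[n%:R]/((n%:Z)%:~R) horner_map. Qed.

End Main.

Section Glasner.
Variable R : realType.

Lemma int_of_scaled (th : R) (m D Q N : nat) (s : R) :
  (0 < m)%N -> (m * D * Q %| N)%N -> `|s| = (m * D)%:R ->
  s * th * Q%:R \is a Num.int -> th * N%:R \is a Num.int.
Proof.
move=> m0 /dvdnP[c ->] sE sQ.
have : `|s| * th * Q%:R \is a Num.int.
  by have [s0|s0] := ger0P s; rewrite ?mulNr ?rpredN.
rewrite sE => sQ'; have -> : th * (c * (m * D * Q))%:R =
    c%:R * ((m * D)%:R * th * Q%:R) by rewrite !natrM; ring.
by rewrite rpredM// rpred_nat.
Qed.

(** The linear system expressing the coefficients of degrees [i] and [j] in terms
of [v * a] and [w * b] has a nonzero determinant [D]; inverting it shows that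
[D * Q * v * a] and [D * Q * w * b] are integers when the second case of the
dichotomy holds. The factor [L`!] absorbs the nonzero one among [v] and [w]. *)
Lemma correlation_small (P1 P2 : {poly int}) (L : nat) (eta : R) :
  no_constant_combination R P1 P2 -> 0 < eta ->
  exists2 N : nat, (0 < N)%N & forall (v w : int) (a b : R),
    (`|v| <= L)%N -> (`|w| <= L)%N -> ~~ ((v == 0) && (w == 0)) ->
    a * N%:R \isn't a Num.int -> b * N%:R \isn't a Num.int ->
    mean_le (fun n => ccos (v%:~R * (P1.[n%:Z]%:~R * a) + w%:~R * (P2.[n%:Z]%:~R * b))) eta.
Proof.
move=> /independent_coefs[i [j [i0 j0 minor]]] eta0.
have [Q Q0 weyl] := weyl_dichotomy (maxn (size P1) (size P2)) eta0.
set D := absz (P1`_i * P2`_j - P1`_j * P2`_i)%R.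
have D0 : (0 < D)%N by rewrite lt0n absz_eq0.
exists (L`! * D * Q)%N => [|v w a b vL wL vw aN bN].
  by rewrite !muln_gt0 fact_gt0 D0.
pose f : {poly R} := (v%:~R * a) *: map_poly intr P1 + (w%:~R * b) *: map_poly intr P2.
have fE k : f`_k = v%:~R * a * (P1`_k)%:~R + w%:~R * b * (P2`_k)%:~R.
  by rewrite coefD !coefZ !coef_map.
have sf : (size f <= (maxn (size P1) (size P2)).+1)%N.
  rewrite leqW// (leq_trans (size_polyD _ _))// geq_max !(leq_trans (size_scale_leq _ _))//.
    by rewrite (leq_trans (size_poly _ _))// leq_maxr.
  by rewrite (leq_trans (size_poly _ _))// leq_maxl.
have [small|fQ] := weyl f sf.
  apply: mean_le_eq small => n; congr ccos.
  by rewrite /f hornerD !hornerZ !horner_map_intr; ring.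
have elim (c c' : int) : (f`_i * c%:~R - f`_j * c'%:~R) * Q%:R \is a Num.int.
  rewrite mulrBl rpredB// mulrAC rpredM ?intr_int//; exact: fQ.
have dvd (m : int) : (`|m| <= L)%N -> m != 0 -> (`|m| * D * Q %| L`! * D * Q)%N.
  by move=> mL m0; rewrite !dvdn_mul// dvdn_fact// absz_gt0 m0.
have norm (m : int) : `|(m * (P1`_i * P2`_j - P1`_j * P2`_i))%:~R : R| = (`|m| * D)%:R.
  by rewrite -abszM natr_absz intr_norm.
case: (eqVneq v 0) vw => /= [_ w0|v0 _].
  case/negP: bN; apply: (int_of_scaled _ (dvd w wL w0) (norm w)).
    by rewrite absz_gt0.
  have := elim (- P1`_j) (- P1`_i); rewrite !fE.
  by congr (_ * _ \is a Num.int); rewrite intrM !intrN intrB !intrM; ring.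
case/negP: aN; apply: (int_of_scaled _ (dvd v vL v0) (norm v)).
  by rewrite absz_gt0.
have := elim (P2`_j) (P2`_i); rewrite !fE.
by congr (_ * _ \is a Num.int); rewrite intrM intrB !intrM; ring.
Qed.

(** A choice of [l] for which [card_diag_box] beats [kernel_le] with [L = l + l]:
[l > 4 * c] suffices, as [16 * c ^+ 2 * l ^+ 4 < l ^+ 6] then. *)
Lemma kernel_mean_dominates (s : R) : 0 < s -> exists2 l : nat, (0 < l)%N &
  (2 * s ^- 2) ^+ 2 * (l + l)%:R ^+ 4 + 1 <= (l ^ 6)%:R :> R.
Proof.
move=> s0; set c := 2 * s ^- 2.
have c0 : 0 < c by rewrite mulr_gt0// invr_gt0 exprn_gt0.
pose l := (Num.trunc (4 * c)).+2; exists l => //.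
have lc : 4 * c + 1 <= l%:R.
  by rewrite /l -(natr1 (Num.trunc (4 * c)).+1) lerD2r ltW// truncnS_gt.
have l1 : 1 <= l%:R :> R by rewrite ler1n.
have l2 : (4 * c) ^+ 2 + 1 <= l%:R ^+ 2.
  by apply: (@le_trans _ _ ((4 * c + 1) ^+ 2)); [nra|rewrite lerXn2r// nnegrE; lra].
rewrite natrX natrD; have -> : l%:R ^+ 6 = l%:R ^+ 4 * l%:R ^+ 2 :> R by rewrite -exprD.
apply: le_trans (_ : l%:R ^+ 4 * ((4 * c) ^+ 2 + 1) <= _); last first.
  by rewrite ler_pM2l// exprn_gt0//; lra.
have -> : (l%:R + l%:R) ^+ 4 = 16 * l%:R ^+ 4 :> R by ring.
have : 1 <= l%:R ^+ 4 :> R by rewrite exprn_ege1.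
by move: (l%:R ^+ 4) => t t1; nra.
Qed.

Lemma mean_le_lower_bound (W : nat -> R) (b c : R) : (forall n, 0 <= W n) ->
  (forall n, (0 < n)%N -> b <= W n) -> mean_le W c -> c < b -> False.
Proof.
move=> W0 Wb Wc cb; pose d := (b - c) / 2; have d0 : 0 < d by rewrite divr_gt0// subr_gt0.
have [N [N0 NbD sumN]] : exists N : nat, [/\ (0 < N)%N, b / d < N%:R &
    `|\sum_(n < N) W n| <= (c + d) * N%:R].
  have := filterI (nbhs_infty_gt 0%N) (filterI (nbhs_infty_gtr (b / d)) (Wc d d0)).
  by case=> N _ /(_ N (leqnn N)) [? [? ?]]; exists N.
have : b * (N.-1)%:R <= \sum_(n < N) W n.
  rewrite -(prednK N0) big_ord_recl/= mulr_natr -[X in _ *+ X](card_ord N.-1) -sumr_const.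
  by rewrite ler_wpDl ?W0// ler_sum// => n _; exact: Wb.
move=> /le_trans/(_ (ler_norm _))/le_trans/(_ sumN).
have -> : N.-1%:R = N%:R - 1 :> R by rewrite -[in RHS](prednK N0) -natr1 addrK.
have bE : b = c + 2 * d by rewrite /d; lra.
by move: NbD; rewrite ltr_pdivrMr// bE => NbD; nra.
Qed.

Lemma polynomial_dilation_dense (Y : set (torus R)) (P1 P2 : {poly int}) (e : R) :
  infinite_set Y ->
  (forall y z : torus R, Y y -> Y z -> y.1 = z.1 -> y = z) ->
  (forall y z : torus R, Y y -> Y z -> y.2 = z.2 -> y = z) ->
  no_constant_combination R P1 P2 -> 0 < e -> e <= 2^-1 ->
  exists n : nat, (0 < n)%N /\ eps_dense e (dilate P1.[n%:Z] P2.[n%:Z] Y).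
Proof.
move=> Yinf inj1 inj2 indep e0 e2; apply/not_existsP => none.
have s0 : 0 < sin (pi * e).
  by apply: sin_gt0_pi; have pi0 := pi_gt0 R; apply/andP; split; nra.
have [l l0 kernel] := kernel_mean_dominates s0.
set L := (l + l)%N in kernel.
pose off (r : box L * box L) := ~~ ((freq1 r.1 == freq1 r.2) && (freq2 r.1 == freq2 r.2)).
pose M := #|box L|.
have M0 : (0 < M)%N by rewrite /M card_box expn_gt0 /L; lia.
have MR : 0 < M%:R :> R by rewrite ltr0n.
(* With M quadruples in the kernel, a gap forces a second moment of at least
   k^2 / M^2, while its mean is at most M^2 (k + k^2 eta) = 2 k M^2; hence the choices
   eta = 1 / (4 M^4) and k = 4 M^4. *)
pose eta : R := (4 * M%:R ^+ 4)^-1.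
have eta0 : 0 < eta by rewrite invr_gt0 mulr_gt0// exprn_gt0.
pose k := (4 * M ^ 4)%N.
have k0 : (0 < k)%N by rewrite muln_gt0 expn_gt0 M0.
have [N N0 corr] := correlation_small (L + L) indep eta0.
have [x [xY xsep]] := separated_points k N0 Yinf inj1 inj2.
pose pt n (i : 'I_k) : R * R := (P1.[Posz n]%:~R * (x i).1, P2.[Posz n]%:~R * (x i).2).
pose W n := \sum_(r | off r)
   energy (fun i => ((freq1 r.1)%:R - (freq1 r.2)%:R) * (pt n i).1 +
                    ((freq2 r.1)%:R - (freq2 r.2)%:R) * (pt n i).2).
have W_large n : (0 < n)%N -> k%:R ^+ 2 / M%:R ^+ 2 <= W n.
  move=> n0.
  have nd : ~ eps_dense e (dilate P1.[n%:Z] P2.[n%:Z] Y) by move=> dn; apply: (none n).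
  have [al far] := not_eps_dense e0 e2 nd.
  have -> : k%:R = #|'I_k|%:R :> R by rewrite card_ord.
  apply: (large_energy_of_small_kernel (al := al) (B := (2 * sin (pi * e) ^- 2) ^+ 2 * L%:R ^+ 4)).
  - by rewrite card_ord.
  - by move=> i; apply: kernel_le => //; exact: far.
  - by rewrite (le_trans kernel)// ler_nat card_diag_box.
have W_mean : mean_le W (\sum_(r | off r) \sum_(i < k) \sum_(j < k) ((i == j)%:R + eta)).
  rewrite /W /energy; apply: mean_le_sum => r off_r; apply: mean_le_sum => i _; apply: mean_le_sum => j _.
  have [->|ij] := eqVneq i j.
    apply: (mean_le_trans (c := `|1|)); first by rewrite normr1 lerDl ltW.
    by apply: mean_le_eq (mean_le_cst 1) => n; rewrite subrr ccos0.
  have [sep1 sep2] := xsep _ _ ij.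
  have freq_lt (a b c d : 'I_L) : (`|Posz (a + b) - Posz (c + d)| <= L + L)%N.
    have := ltn_ord a; have := ltn_ord b; have := ltn_ord c; have := ltn_ord d; lia.
  rewrite add0r; have := corr (Posz (freq1 r.1) - Posz (freq1 r.2))
    (Posz (freq2 r.1) - Posz (freq2 r.2)) _ _ (freq_lt _ _ _ _) (freq_lt _ _ _ _) _ sep1 sep2.
  rewrite !subr_eq0 !eqz_nat => /(_ off_r); apply: mean_le_eq => n.
  by congr ccos; rewrite /pt/= !intrB; ring.
apply: (mean_le_lower_bound _ W_large W_mean) => [n|].
  by rewrite sumr_ge0// => r _; exact: energy_ge0.
have mainE (i : 'I_k) : \sum_(j < k) ((i == j)%:R + eta) = 1 + k%:R * eta.
  rewrite big_split/= sumr_const card_ord mulr_natl; congr (_ + _).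
  rewrite (bigD1 i)//= eqxx big1 ?addr0// => j ji.
  by rewrite eq_sym (negbTE ji).
under eq_bigr do (under eq_bigr do rewrite mainE; rewrite sumr_const card_ord).
rewrite sumr_const -[_ *+ #|off|]mulr_natl -[_ *+ k]mulr_natl.
have card_off : #|off|%:R <= M%:R ^+ 2 :> R.
  by rewrite -natrX ler_nat (leq_trans (max_card _))// card_prod expnS expn1.
have kE : k%:R = 4 * M%:R ^+ 4 :> R by rewrite natrM natrX.
have keta : k%:R * eta = 1 by rewrite kE mulfV// gt_eqF// mulr_gt0// exprn_gt0.
have kR : 0 < k%:R :> R by rewrite ltr0n.
apply: (@le_lt_trans _ _ (M%:R ^+ 2 * (k%:R * 2))).
  rewrite keta ler_wpM2r// mulr_ge0//; lra.
rewrite ltr_pdivlMr ?exprn_gt0//.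
have -> : k%:R ^+ 2 = 4 * M%:R ^+ 4 * k%:R :> R by rewrite -kE expr2.
have -> : M%:R ^+ 2 * (k%:R * 2) * M%:R ^+ 2 = 2 * M%:R ^+ 4 * k%:R :> R by ring.
by rewrite ltr_pM2r// ltr_pM2r ?exprn_gt0//; lra.
Qed.

End Glasner.

Theorem proposition1p6 (R : realType) (Y : set (torus R))
    (Yinf : infinite_set Y)
    (Yinj1 : forall y z : torus R, Y y -> Y z -> y.1 = z.1 -> y = z)
    (Yinj2 : forall y z : torus R, Y y -> Y z -> y.2 = z.2 -> y = z) :
  (forall e : R, 0 < e ->
     exists n m : nat, [/\ (0 < n)%N, (0 < m)%N &
       eps_dense e (dilate n%:Z m%:Z Y)]) /\
  (forall P1 P2 : {poly int}, no_constant_combination R P1 P2 ->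
   forall e : R, 0 < e ->
     exists n : nat, (0 < n)%N /\
       eps_dense e (dilate P1.[n%:Z] P2.[n%:Z] Y)).
Proof.
have poly_case P1 P2 : no_constant_combination R P1 P2 -> forall e : R, 0 < e ->
    exists n : nat, (0 < n)%N /\ eps_dense e (dilate P1.[n%:Z] P2.[n%:Z] Y).
  move=> indep e e0; pose e' := Num.min e 2^-1.
  have e'0 : 0 < e' by rewrite lt_min e0 invr_gt0 ltr0n.
  have e'2 : e' <= 2^-1 by rewrite ge_min lexx orbT.
  have [n [n0 dense]] := polynomial_dilation_dense Yinf Yinj1 Yinj2 indep e'0 e'2.
  by exists n; split=> //; apply: eps_dense_le dense; rewrite ge_min lexx.
split=> // e e0.
have indep : no_constant_combination R 'X 'X^2.
  move=> c1 c2 c_neq0 [c]; rewrite map_polyX map_polyXn => /polyP cE.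
  apply: c_neq0; have := cE 1%N; have := cE 2%N.
  rewrite !coefD !coefZ !coefX !coefXn !coefC/= !mulr0 !mulr1 addr0 add0r.
  by move=> -> ->.
have [n [n0 dense]] := poly_case _ _ indep e e0.
exists n, (n ^ 2)%N; split=> //; first by rewrite expn_gt0 n0.
by move: dense; rewrite hornerX hornerXn expr2 -PoszM mulnn.
Qed.
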